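(* Let $\mathbb{C}^9$ have basis $\{x_{ij}\}_{1\le i,j\le 3}$ and let $$\det_3=\sum_{\sigma,\tau\in\mathfrak{S}_3}(-1)^\tau x_{\sigma(1)\tau(1)}\otimes x_{\sigma(2)\tau(2)}\otimes x_{\sigma(3)\tau(3)}\in S^3\mathbb{C}^9\subset(\mathbb{C}^9)^{\otimes 3}.$$ Then the Waring rank of $\det_3$ satisfies $\mathbf{R}_S(\det_3)\le 18$.
   Context: A symmetric tensor $T\in S^3\mathbb{C}^m\subseteq\mathbb{C}^m\otimes\mathbb{C}^m\otimes\mathbb{C}^m$ has Waring rank one if $T=a\otimes a\otimes a$ for some $a\in\mathbb{C}^m$; the Waring rank $\mathbf{R}_S(T)$ is the smallest $r$ such that $T$ is a sum of $r$ tensors of Waring rank one. $(-1)^\tau$ is the sign of $\tau$.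
   Formalization: The formal det_3 carries the sign (-1)^σ(-1)^τ instead of (-1)^τ: with (-1)^τ alone the displayed sum is nonzero and skew-symmetric, so it is not in S^3 C^9 and has no Waring rank. *)

(* Defs.v *)
From mathcomp Require Import all_boot all_order all_fingroup all_algebra.
From mathcomp Require Import reals complex.

Set Implicit Arguments.
Unset Strict Implicit.
Unset Printing Implicit Defensive.

Import GRing.Theory.
Local Open Scope ring_scope.

(* A tensor of order three is its array of coordinates: a multi-index
   p : {ffun 'I_3 -> 'I_m} stands for e_(p 0) (x) e_(p 1) (x) e_(p 2), where e
   is the standard basis of K^m.  The codomain is K^o so that the type is a
   left K-module. *)
Notation tensor3 K m := {ffun {ffun 'I_3 -> 'I_m} -> K^o}.

(* v 0 (x) v 1 (x) v 2 *)
Definition tens3 (K : fieldType) (m : nat) (v : 'I_3 -> 'rV[K]_m) :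
    tensor3 K m :=
  [ffun p : {ffun 'I_3 -> 'I_m} => \prod_(k < 3) v k 0 (p k)].

Definition symmetric_tensor (K : fieldType) (m : nat) (T : tensor3 K m) : Prop :=
  forall (s : 'S_3) (p : {ffun 'I_3 -> 'I_m}), T [ffun k => p (s k)] = T p.

Definition waring_rank_one (K : fieldType) (m : nat) (T : tensor3 K m) : Prop :=
  exists a : 'rV[K]_m, T = tens3 (fun=> a).

Definition waring_decomposable (K : fieldType) (m : nat) (T : tensor3 K m)
    (r : nat) : Prop :=
  exists U : 'I_r -> tensor3 K m,
    (forall k, waring_rank_one (U k)) /\ T = \sum_(k < r) U k.

(* Stated as a relation, so that a tensor without any decomposition has no
   Waring rank rather than a default one. *)
Definition is_waring_rank (K : fieldType) (m : nat) (T : tensor3 K m)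
    (r : nat) : Prop :=
  waring_decomposable T r /\
  (forall r', waring_decomposable T r' -> (r <= r')%N).

(* Both signs are needed for a symmetric tensor: with (-1) ^+ t alone the sum
   is skew-symmetric under permutation of the three factors.  This is six times
   the polarization of the 3 x 3 determinant in the coordinates x i j. *)
Definition det3 (K : fieldType) (m : nat) (x : 'I_3 -> 'I_3 -> 'rV[K]_m) :
    tensor3 K m :=
  \sum_(s : 'S_3) \sum_(t : 'S_3)
    ((-1) ^+ s * (-1) ^+ t) *: tens3 (fun k => x (s k) (t k)).

(* Main.v *)
Require Import Defs.
From mathcomp Require Import all_boot all_order all_fingroup all_algebra.
From mathcomp Require Import reals complex.
From mathcomp Require Import boolp ring.

Set Implicit Arguments.
Unset Strict Implicit.
Unset Printing Implicit Defensive.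

Import GRing.Theory.
Local Open Scope ring_scope.

(** Let [w] be a primitive cube root of unity. For each permutation [s], the
    three cubes of [a + w^j b + w^(2j) c] ([j < 3]), with [a, b, c] the
    entries [x l (s l)], sum to [3 (a^3 + b^3 + c^3) + 18 abc]. Every entry of
    the matrix lies on one even and one odd generalized diagonal, so in the
    signed sum over the six permutations the pure cubes cancel and only the
    determinant survives: this takes [6 * 3 = 18] cubes, the scalars being
    absorbed by cube roots. *)

Lemma tens3_cube_symmetric (K : fieldType) (m : nat) (a : 'rV[K]_m) :
  symmetric_tensor (tens3 (fun=> a)).
Proof.
move=> s p; rewrite !ffunE [RHS](reindex_perm s).
by apply: eq_bigr => k _; rewrite ffunE.
Qed.

(** This gives the symmetry of [det3 x] for free, once it is written as a sum of cubes. *)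
Lemma waring_decomposable_symmetric (K : fieldType) (m : nat)
    (T : tensor3 K m) (r : nat) :
  waring_decomposable T r -> symmetric_tensor T.
Proof.
case=> U [rk1 ->] s p; rewrite !sum_ffunE; apply: eq_bigr => k _.
by have [a ->] := rk1 k; apply: tens3_cube_symmetric.
Qed.

Lemma waring_decomposable_sum (K : fieldType) (m : nat) (I : finType)
    (a : I -> 'rV[K]_m) :
  waring_decomposable (\sum_i tens3 (fun=> a i)) #|I|.
Proof.
exists (fun k => tens3 (fun=> a (enum_val k))); split=> [k|]; first by eexists.
by rewrite (big_enum_val (A := I)).
Qed.

Lemma waring_rank_le (K : fieldType) (m : nat) (T : tensor3 K m) (r : nat) :
  waring_decomposable T r ->
  exists r', is_waring_rank T r' /\ (r' <= r)%N.
Proof.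
(* Decomposability is turned into a boolean classically, so that a least length can be extracted. *)
move=> Tr; have exT : exists n, `[< waring_decomposable T n >].
  by exists r; apply/asboolP.
case: (ex_minnP exT) => r' /asboolP Tr' minr'.
exists r'; split; last by apply: minr'; apply/asboolP.
by split=> // n Tn; apply: minr'; apply/asboolP.
Qed.

(* The sum is the determinant of the matrix with entries
   [\prod_(k | f k == i) y k i j], whose rows [i1] and [i2] are all ones. *)
Lemma alternating_sum_missing2 (K : fieldType) (I : finType) (n : nat)
    (f : I -> 'I_n) (y : I -> 'I_n -> 'I_n -> K) (i1 i2 : 'I_n) :
    i1 != i2 -> (forall k, (f k != i1) && (f k != i2)) ->
  \sum_(s : 'S_n) (-1) ^+ s * \prod_k y k (f k) (s (f k)) = 0.
Proof.
move=> i12 fi; pose M := \matrix_(i, j) \prod_(k | f k == i) y k i j.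
transitivity (\det M); last first.
  apply: (determinant_alternate i12) => j; rewrite !mxE !big_pred0 // => k.
    by case/andP: (fi k) => _ /negPf.
  by case/andP: (fi k) => /negPf.
apply: eq_bigr => s _; congr (_ * _).
rewrite (partition_big f predT) //=; apply: eq_bigr => i _.
by rewrite mxE; apply: eq_bigr => k /eqP ->.
Qed.

(** If two values equal [a] and the third is [b], the sum is [b - a] modulo 3. Divisibility by 3
    then forces [a = b], so [f] is constant. *)
Lemma ffun3_missing2 (f : {ffun 'I_3 -> 'I_3}) :
    ~~ injectiveb f -> (3 %| \sum_k f k)%N ->
  exists i1 i2, i1 != i2 /\ forall k, (f k != i1) && (f k != i2).
Proof.
have three k : [\/ k = 0, k = 1 | k = 2%:R :> 'I_3].
  by case: k => [[|[|[|//]]] ?]; [apply: Or31|apply: Or32|apply: Or33];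
    apply: val_inj.
move=> finj f3.
suff [c fc] : exists c, forall k, f k = c.
  exists (c + 1), (c + 2%:R); split; first by case: (three c) => ->.
  by move=> k; rewrite fc; case: (three c) => ->.
exists (f 0) => k; move: f3 finj.
rewrite !big_ord_recl big_ord0 /=.
have -> : lift ord0 ord0 = 1 :> 'I_3 by apply: val_inj.
have -> : lift ord0 (lift ord0 ord0) = 2%:R :> 'I_3 by apply: val_inj.
have injP : f 0 != f 1 -> f 0 != f 2%:R -> f 1 != f 2%:R -> injectiveb f.
  move=> h01 h02 h12; apply/injectiveP => u v.
  by case: (three u) => ->; case: (three v) => -> // /eqP;
    rewrite ?(negPf h01) ?(negPf h02) ?(negPf h12) // eq_sym
      ?(negPf h01) ?(negPf h02) ?(negPf h12).
move: injP; case: (three k) => ->;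
  case: (three (f 0)) => ->; case: (three (f 1)) => ->;
  by case: (three (f 2%:R)) => -> //= H _; rewrite H.
Qed.

(** The exponent of [w] matters only modulo 3. For the residues 1 and 2 the three terms are 1, [w]
    and [w ^+ 2] in some order. *)
Lemma sum_cube_root_unity (K : fieldType) (w : K) (n : nat) :
    w ^+ 2 + w + 1 = 0 ->
  \sum_(j < 3) w ^+ (j * n) = if (3 %| n)%N then 3%:R else 0.
Proof.
move=> w0.
have w3 : w ^+ 3 = 1.
  have -> : w ^+ 3 = (w - 1) * (w ^+ 2 + w + 1) + 1 by ring.
  by rewrite w0 mulr0 add0r.
under eq_bigr => j _ do
  rewrite -(expr_mod _ w3) -modnMmr (expr_mod _ w3).
rewrite !big_ord_recl big_ord0 /= addr0 mul0n mul1n expr0 /dvdn.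
have : (n %% 3 < 3)%N by rewrite ltn_mod.
case: (n %% 3)%N => [|[|[|//]]] _ /=.
- by ring.
- by rewrite -w0 /bump /=; ring.
- have -> : w ^+ (bump 0 1 * 2) = w ^+ 3 * w by rewrite -exprSr.
  by rewrite -w0 w3 /bump /=; ring.
Qed.

(** Keeping the factor 3 on the left avoids any division, so the identity holds in every
    characteristic. *)
Lemma det3_cubes (K : fieldType) (m : nat) (x : 'I_3 -> 'I_3 -> 'rV[K]_m)
    (w : K) :
    w ^+ 2 + w + 1 = 0 ->
  3%:R *: det3 x =
    \sum_(s : 'S_3) \sum_(j < 3) (-1) ^+ s *:
      tens3 (fun=> \sum_(l < 3) w ^+ (j * l) *: x l (s l)).
Proof.
move=> w0; apply/ffunP => p.
pose y (k l q : 'I_3) := x l q 0 (p k).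
pose F (f : {ffun 'I_3 -> 'I_3}) :=
  \sum_(s : 'S_3) (-1) ^+ s * \prod_k y k (f k) (s (f k)).
(* When the cubes are expanded, [f k] is the row chosen in slot [k]. The index [j] enters only
   through the power of [w], so its sum factors out as a filter on [\sum_k f k]. *)
transitivity (\sum_(f : {ffun 'I_3 -> 'I_3})
    (\sum_(j < 3) w ^+ (j * \sum_k f k)) * F f); last first.
  rewrite sum_ffunE.
  under [RHS]eq_bigr => s _.
    rewrite sum_ffunE.
    under eq_bigr => j _.
      rewrite !ffunE.
      under eq_bigr => k _.
        rewrite summxE.
        under eq_bigr => l _ do rewrite mxE.
      over.
      rewrite bigA_distr_bigA /=.
    over.
  over.
  under [LHS]eq_bigr => f _ do rewrite mulr_sumr.
  rewrite exchange_big; apply: eq_bigr => s _ /=.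
  under [LHS]eq_bigr => f _ do rewrite mulr_suml.
  rewrite exchange_big; apply: eq_bigr => j _ /=.
  rewrite scaler_sumr; apply: eq_bigr => f _.
  by rewrite mulrCA big_split /= prodrXr -big_distrr.
rewrite (bigID (fun f : {ffun 'I_3 -> 'I_3} => injectiveb f)) /=.
(* A non-injective [f] is killed by the filter, or else it misses two rows and the signed sum over
   [s] vanishes. *)
rewrite addrC big1 ?add0r => [|f Uf]; last first.
  rewrite sum_cube_root_unity //; case: ifP => [f3|]; last by rewrite mul0r.
  have [i1 [i2 [i12 fi]]] := ffun3_missing2 Uf f3.
  by rewrite /F (alternating_sum_missing2 _ i12) ?mulr0.
rewrite (reindex (@pval _)) /=; last first.
  pose in_Sn := insubd (1%g : 'S_3).
  by exists in_Sn => /= f Uf; first apply: val_inj; apply: insubdK.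
rewrite !ffunE sum_ffunE scaler_sumr; apply: eq_big => [u|u _].
  by rewrite (valP u).
have -> : (\sum_(k < 3) pval u k = 3)%N.
  transitivity (\sum_(k < 3) k)%N; last by rewrite !big_ord_recl big_ord0.
  by rewrite [RHS](reindex_perm u); apply: eq_bigr => k _; rewrite pvalE.
rewrite sum_cube_root_unity // sum_ffunE; congr (_ * _).
(* Replacing [t] by [u * t] in [det3] turns column [t k] into [t (u k)], and the two signs of [u]
   cancel. *)
rewrite (reindex_inj (mulgI u)); apply: eq_bigr => t _ /=.
rewrite !ffunE odd_permM signr_addb mulrA -signr_addb addbb mul1r.
by congr (_ * _); apply: eq_bigr => k _; rewrite permM pvalE.
Qed.

Lemma det3_waring18 (K : closedFieldType) (m : nat)
    (x : 'I_3 -> 'I_3 -> 'rV[K]_m) :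
  3%:R != 0 :> K -> waring_decomposable (det3 x) 18%N.
Proof.
move=> K3.
have [w w0] : exists w : K, w ^+ 2 + w + 1 = 0.
  have [w] := @GRing.solve_monicpoly K 2 (fun=> -1) isT.
  rewrite !big_ord_recl big_ord0 => w2; exists w.
  by rewrite w2 /bump /=; ring.
(* [z] absorbs the factor 3 of [det3_cubes]; a sign is its own cube and needs no root. *)
have [z z3] : exists z : K, z ^+ 3 = 3%:R^-1.
  have [z] := @GRing.solve_monicpoly K 3 (fun i => 3%:R^-1 *+ (i == 0%N)) isT.
  rewrite !big_ord_recl big_ord0 /= => z3; exists z.
  by rewrite z3 !mul0r !addr0 expr0 mulr1.
have cubeZ (c : K) (v : 'rV[K]_m) :
    tens3 (fun=> c *: v) = c ^+ 3 *: tens3 (fun=> v).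
  apply/ffunP => p; rewrite !ffunE.
  under eq_bigr do rewrite mxE.
  by rewrite big_split /= prodr_const card_ord.
have -> : det3 x = \sum_(i : 'S_3 * 'I_3)
    tens3 (fun=> (z * (-1) ^+ i.1) *:
      \sum_(l < 3) w ^+ (i.2 * l) *: x l (i.1 l)).
  rewrite -[LHS](scalerK K3) (det3_cubes x w0).
  rewrite pair_bigA /= scaler_sumr; apply: eq_bigr => -[s j] _ /=.
  rewrite cubeZ scalerA; congr (_ *: _).
  by rewrite exprMn z3 exprS sqrr_sign mulr1.
have -> : 18%N = #|{: 'S_3 * 'I_3}| by rewrite card_prod card_Sn card_ord.
exact: waring_decomposable_sum.
Qed.

Theorem theorem2p11 (R : realType) (x : 'I_3 -> 'I_3 -> 'rV[R[i]]_9)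
    (hx : basis_of {: 'rV[R[i]]_9} [seq x p.1 p.2 | p : 'I_3 * 'I_3]) :
  symmetric_tensor (det3 x) /\
  exists r : nat, is_waring_rank (det3 x) r /\ (r <= 18)%N.
Proof.
have dec : waring_decomposable (det3 x) 18%N.
  by apply: det3_waring18; rewrite Num.Theory.pnatr_eq0.
by split; [apply: waring_decomposable_symmetric dec | apply: waring_rank_le].
Qed.
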